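(* Let $G=(V,E)$ be a directed graph with $m=|E|$, let $H$ be a maximal eulerian subgraph of $G$, and let $r:V\to\mathbb{Z}$ be a rank function conforming $H$ such that $\mathrm{slack}(e,r)\le m$ for every edge $e\in E(H)$. Then the algorithm $\mathrm{MinAgony}(G,H,r)$ takes $O(m^2)$ time.
   Context: Graphs are finite and directed, $G=(V,E)$, $n=|V|$, $m=|E|$; subgraphs of $G$ are taken on the same vertex set $V$, and $E(H)$ is the edge set of $H$. A rank function is a map $r:V\to\mathbb{Z}$. An edge $(u,v)$ is forward w.r.t. $r$ if $r(u)<r(v)$ and backward if $r(u)\ge r(v)$. Agony: $q((u,v),r)=\max(r(u)-r(v)+1,0)$ and $q(G,r)=\sum_{e\in E}q(e,r)$. Slack: $\mathrm{slack}((u,v),r)=\max(r(v)-r(u)-1,0)$. A graph is eulerian if every vertex has in-degree equal to out-degree (connectivity is not required). A subgraph $H$ of $G$ is a maximal eulerian subgraph if it is eulerian and no eulerian subgraph of $G$ has an edge set strictly containing $E(H)$. A rank function $r$ conforms $H$ if all edges of $G$ that are backward w.r.t. $r$ lie in $E(H)$. Algorithm Relief$(H,r,G,p,s)$. Input: a graph $G=(V,E)$, a maximal eulerian subgraph $H$, a rank function $r$ conforming $H$, and an edge $(p,s)\in E(H)$ with $\mathrm{slack}((p,s),r)>0$. (1) Set $F:=E(H)$, $r':=r$, $t(v):=0$ for all $v\in V$; then set $t(p):=r(s)-r(p)-1$ and let $S$ be a priority queue (largest priority first) containing only $p$, with priority $t(p)$. (2) While $S$ is not empty: pop a vertex $u$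 of highest priority from $S$ and set $r'(u):=r'(u)+t(u)$. For each $(u,v)\in E\setminus F$ with $r'(v)\le r'(u)$: let $t:=r'(u)+1-r'(v)$; if $t>t(v)$, set $t(v):=t$, add $v$ to $S$ with priority $t$ (updating its priority if $v$ is already in $S$), and set $\mathrm{parent}(v):=u$. Then for each $e=(w,u)\in F$ with $\mathrm{slack}(e,r')>\mathrm{slack}(e,r)$: let $t:=\mathrm{slack}(e,r')-\mathrm{slack}(e,r)$; if $t>t(w)$, set $t(w):=t$, add $w$ to $S$ with priority $t$ (updating its priority if $w$ is already in $S$), and set $\mathrm{parent}(w):=u$. (3) After the loop, if $\mathrm{slack}((p,s),r')>0$: let $O$ be the set of edges of $E$ along the path from $s$ to $p$ obtained by following the parent links (for each vertex $x\ne p$ on this path, the edge joining $x$ and $\mathrm{parent}(x)$ is the one that was being processed when $\mathrm{parent}(x)$ was last set); replace $F$ by $(F\setminus O)\cup(O\setminus F)$ and then delete $(p,s)$ from $F$. (4) Return $H'=(V,F)$ and $r'$. Algorithm MinAgony$(G,H,r)$: while $q(G,r)>|E(H)|$, pick an edge $(p,s)\in E(H)$ with largest slack w.r.t. $r$ and replace $(H,r)$ by the output of Relief$(H,r,G,p,s)$. Return $H,r$. Running time counts elementary operations (integer arithmetic and comparisons at unit cost), the priority queue being implemented by a suitable data structure. In running-time bounds, $n=O(m)$ is understood, so $O(n+m)$ is written $O(m)$. *)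

(* Defs.v *)
From HB Require Import structures.
From mathcomp Require Import all_boot all_order all_algebra.
Set Implicit Arguments.
Unset Strict Implicit.
Unset Printing Implicit Defensive.
Import Order.TTheory GRing.Theory Num.Theory.
Local Open Scope ring_scope.

Section Graph.
Variable V : finType.
Implicit Types (e : V * V) (E H : {set V * V}) (r : {ffun V -> int}).

Definition edge_agony e r : int := Num.max (r e.1 - r e.2 + 1) 0.
Definition agony E r : int := \sum_(e in E) edge_agony e r.
Definition slack e r : int := Num.max (r e.2 - r e.1 - 1) 0.

Definition backward e r : bool := r e.2 <= r e.1.

Definition eulerian H : bool :=
  [forall v, #|[set e in H | e.2 == v]| == #|[set e in H | e.1 == v]|].

Definition max_eulerian E H : bool :=
  maxset (fun F => (F \subset E) && eulerian F) H.

Definition conforms E H r : Prop :=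
  forall e, e \in E -> backward e r -> e \in H.
End Graph.

(* The language in which the priority queue has to be implemented: natural
   number registers, arrays of unbounded length with indirect access, addition,
   truncated subtraction and comparison.  Evaluating a node of an expression and
   executing a command node each take one time unit. *)
Inductive expr : Type :=
| Lit of nat
| Reg of nat
| Get of nat & expr
| Add of expr & expr
| Sub of expr & expr.

Inductive cmd : Type :=
| Skip
| Set_ of nat & expr
| Put of nat & expr & expr
| Seq of cmd & cmd
| IfLt of expr & expr & cmd & cmd
| WhileLt of expr & expr & cmd.

Record store := Store { regs : nat -> nat; arrs : nat -> nat -> nat }.

Definition upd (T : Type) (g : nat -> T) (x : nat) (a : T) : nat -> T :=
  fun y => if y == x then a else g y.
Definition set_reg (m : store) (x a : nat) : store :=
  Store (upd (regs m) x a) (arrs m).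
Definition set_arr (m : store) (x i a : nat) : store :=
  Store (regs m) (upd (arrs m) x (upd (arrs m x) i a)).

Fixpoint eval (m : store) (a : expr) : nat :=
  match a with
  | Lit k => k
  | Reg x => regs m x
  | Get x i => arrs m x (eval m i)
  | Add a b => (eval m a + eval m b)%N
  | Sub a b => (eval m a - eval m b)%N
  end.

Fixpoint ecost (a : expr) : nat :=
  match a with
  | Lit _ | Reg _ => 1
  | Get _ i => (ecost i).+1
  | Add a b | Sub a b => (ecost a + ecost b).+1%N
  end.

(* [exec c m k m']: started in [m], the command [c] stops in [m'] after [k]
   time units. *)
Inductive exec : cmd -> store -> nat -> store -> Prop :=
| ExecSkip m : exec Skip m 1 m
| ExecSet m x a : exec (Set_ x a) m (ecost a).+1%N (set_reg m x (eval m a))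
| ExecPut m x i a :
    exec (Put x i a) m (ecost i + ecost a).+1%N (set_arr m x (eval m i) (eval m a))
| ExecSeq c d m k m' l m'' :
    exec c m k m' -> exec d m' l m'' -> exec (Seq c d) m (k + l).+1%N m''
| ExecIfT a b c d m k m' : (eval m a < eval m b)%N -> exec c m k m' ->
    exec (IfLt a b c d) m (ecost a + ecost b + k).+1%N m'
| ExecIfF a b c d m k m' : (eval m b <= eval m a)%N -> exec d m k m' ->
    exec (IfLt a b c d) m (ecost a + ecost b + k).+1%N m'
| ExecWhileT a b c m k m' l m'' : (eval m a < eval m b)%N ->
    exec c m k m' -> exec (WhileLt a b c) m' l m'' ->
    exec (WhileLt a b c) m (ecost a + ecost b + k + l).+1%N m''
| ExecWhileF a b c m : (eval m b <= eval m a)%N ->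
    exec (WhileLt a b c) m (ecost a + ecost b).+1%N m.

(* Calling conventions (keys are the vertex numbers 0, ..., n-1):
   - [pq_init] creates an empty queue, given n in register 0 and the number of
     edges in register 1;
   - [pq_insert] gives the key in register 0 the priority in register 1, whether
     or not the key is already in the queue;
   - [pq_pop] leaves 0 in register 0 if the queue is empty, and otherwise removes
     a key of highest priority and leaves its successor in register 0.
   A [pqueue] need not follow them, but one that gives a wrong answer, or does
   not stop, makes the algorithm below get stuck. *)
Record pqueue := PQueue { pq_init : cmd; pq_insert : cmd; pq_pop : cmd }.

Definition call (c : cmd) (m : store) (a b : nat) : nat -> store -> Prop :=
  exec c (set_reg (set_reg m 0 a) 1 b).

Section Algorithm.
Variable V : finType.
Notation edge := (V * V)%type.
Notation ranks := {ffun V -> int}.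

(* The variables of Relief.  The priority of a vertex of [fS] is its value of
   [ft].  A parent link carries the edge that was processed when it was set. *)
Record frame := Frame {
  fF : {set edge};
  fr : ranks;
  fps : edge;
  fr' : ranks;
  ft : {ffun V -> int};
  fS : {set V};
  fpar : {ffun V -> option (V * edge)} }.

Definition relief_init (H : {set edge}) (r : ranks) (ps : edge) : frame :=
  Frame H r ps r
    [ffun v => if v == ps.1 then r ps.2 - r ps.1 - 1 else 0]
    [set ps.1] [ffun=> None].

Definition raise (f : frame) (u : V) : frame :=
  Frame (fF f) (fr f) (fps f)
    [ffun v => if v == u then fr' f u + ft f u else fr' f v]
    (ft f) (fS f :\ u) (fpar f).

Definition enqueue (f : frame) (v : V) (t : int) (u : V) (e : edge) : frame :=
  Frame (fF f) (fr f) (fps f) (fr' f)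
    [ffun x => if x == v then t else ft f x]
    (v |: fS f)
    [ffun x => if x == v then Some (u, e) else fpar f x].

(* [Scan f u A B m]: [u] has been popped, [A] and [B] are the edges out of [u]
   and into [u] still to be examined ([A] before [B]).
   [Insert f v u A B m]: [v] has just been added to S (or had its priority
   changed) while scanning [u]; the concrete queue is to be updated.
   [Walk f x O m]: the parent links have been followed from s to [x], and [O] is
   the set of edges met. *)
Inductive state : Type :=
| Test of {set edge} & ranks & store
| Pick of {set edge} & ranks & store
| Enter of {set edge} & ranks & edge & store
| Loop of frame & store
| Scan of frame & V & {set edge} & {set edge} & store
| Insert of frame & V & V & {set edge} & {set edge} & store
| After of frame & store
| Walk of frame & V & {set edge} & store
| Done of {set edge} & ranks.

Definition vnum (v : V) : nat := enum_rank v.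

(* When vertex [u] is scanned, the priority offered to the other end of [e]. *)
Definition out_gain (f : frame) (e : edge) : int := fr' f e.1 + 1 - fr' f e.2.
Definition in_gain (f : frame) (e : edge) : int :=
  slack e (fr' f) - slack e (fr f).

Definition out_relaxes (f : frame) (e : edge) : bool :=
  [&& e \notin fF f, fr' f e.2 <= fr' f e.1 & ft f e.2 < out_gain f e].
Definition in_relaxes (f : frame) (e : edge) : bool :=
  [&& e \in fF f, slack e (fr f) < slack e (fr' f) & ft f e.1 < in_gain f e].

(* [step Q E s k s']: with the queue implementation [Q], MinAgony on the graph
   with edge set [E] can go from [s] to [s'] in [k] time units.  One unit stands
   for a bounded number of elementary operations; loops over all vertices or
   edges, the queue operations and the final update of F are charged by size or
   by execution.  Ties and the order of the edges in a scan are unconstrained. *)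
Inductive step (Q : pqueue) (E : {set edge}) : state -> nat -> state -> Prop :=
| TestHalt (H : {set edge}) r m : agony E r <= #|H|%:Z ->
    step Q E (Test H r m) #|E|.+1 (Done H r)
| TestGo (H : {set edge}) r m : #|H|%:Z < agony E r ->
    step Q E (Test H r m) #|E|.+1 (Pick H r m)
| PickEdge (H : {set edge}) r e m : e \in H ->
    (forall e', e' \in H -> slack e' r <= slack e r) ->
    step Q E (Pick H r m) #|E|.+1 (Enter H r e m)
| EnterRelief (H : {set edge}) r e m k m1 l m2 : 0 < slack e r ->
    let f := relief_init H r e in
    call (pq_init Q) m #|V| #|E| k m1 ->
    call (pq_insert Q) m1 (vnum e.1) `|ft f e.1|%N l m2 ->
    step Q E (Enter H r e m) (#|V| + #|E| + k + l).+1%N (Loop f m2)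
| LoopPop f u m k m' : u \in fS f -> (forall v, v \in fS f -> ft f v <= ft f u) ->
    call (pq_pop Q) m 0 0 k m' -> regs m' 0%N = (vnum u).+1 ->
    step Q E (Loop f m) k.+1
      (Scan (raise f u) u [set e in E | e.1 == u] [set e in E | e.2 == u] m')
| LoopExit f m k m' : fS f = set0 ->
    call (pq_pop Q) m 0 0 k m' -> regs m' 0%N = 0%N ->
    step Q E (Loop f m) k.+1 (After f m')
| ScanOutSkip f u (A B : {set edge}) e m : e \in A -> ~~ out_relaxes f e ->
    step Q E (Scan f u A B m) 1 (Scan f u (A :\ e) B m)
| ScanOut f u (A B : {set edge}) e m : e \in A -> out_relaxes f e ->
    step Q E (Scan f u A B m) 1
      (Insert (enqueue f e.2 (out_gain f e) u e) e.2 u (A :\ e) B m)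
| ScanInSkip f u (B : {set edge}) e m : e \in B -> ~~ in_relaxes f e ->
    step Q E (Scan f u set0 B m) 1 (Scan f u set0 (B :\ e) m)
| ScanIn f u (B : {set edge}) e m : e \in B -> in_relaxes f e ->
    step Q E (Scan f u set0 B m) 1
      (Insert (enqueue f e.1 (in_gain f e) u e) e.1 u set0 (B :\ e) m)
| ScanEnd f u m : step Q E (Scan f u set0 set0 m) 1 (Loop f m)
| InsertCall f v u (A B : {set edge}) m k m' :
    call (pq_insert Q) m (vnum v) `|ft f v|%N k m' ->
    step Q E (Insert f v u A B m) k.+1 (Scan f u A B m')
| AfterKeep f m : slack (fps f) (fr' f) <= 0 ->
    step Q E (After f m) 1 (Test (fF f) (fr' f) m)
| AfterWalk f m : 0 < slack (fps f) (fr' f) ->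
    step Q E (After f m) 1 (Walk f (fps f).2 set0 m)
| WalkUp f x y e (O : {set edge}) m : x != (fps f).1 -> fpar f x = Some (y, e) ->
    step Q E (Walk f x O m) 1 (Walk f y (e |: O) m)
| WalkEnd f (O : {set edge}) m :
    step Q E (Walk f (fps f).1 O m) #|O|.+1
      (Test (((fF f :\: O) :|: (O :\: fF f)) :\ fps f) (fr' f) m).

(* Every run from [s] reaches [Done], never gets stuck, and takes at most [c]
   time units in total. *)
Inductive halts_within (Q : pqueue) (E : {set edge}) : nat -> state -> Prop :=
| HaltsDone c H r : halts_within Q E c (Done H r)
| HaltsStep c s :
    (exists k s', step Q E s k s') ->
    (forall k s', step Q E s k s' ->
       (k <= c)%N /\ halts_within Q E (c - k)%N s') ->
    halts_within Q E c s.

(* The contents of the queue's memory before the run are arbitrary. *)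
Definition minagony_time_le (Q : pqueue) (E H : {set edge}) (r : ranks)
    (c : nat) : Prop :=
  forall m : store, halts_within Q E c (Test H r m).
End Algorithm.

(* Main.v *)
Require Import Defs.
From mathcomp Require Import all_boot all_order all_algebra zify.
Import Order.TTheory GRing.Theory Num.Theory.
Set Implicit Arguments.
Unset Strict Implicit.
Unset Printing Implicit Defensive.
Local Open Scope ring_scope.

(* An eulerian subgraph H conformed by r satisfies q(G, r) = |E(H)| + total slack
   of E(H).  So MinAgony stops as soon as no edge of H has positive slack.  A call
   of Relief never increases the slack of an edge that stays in H, adds only edges
   of slack 0, and either deletes (p, s) or brings its slack to 0.  Hence the number
   of edges of positive slack drops at each call, and there are at most m calls.

   The priorities popped during one call are non-increasing, so each vertex is
   popped at most once, and they are at most the slack of (p, s), hence at most m.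
   A bucket queue scanned downwards from m therefore spends O(n + m) per call. *)

(** * Determinism of the queue language *)

(** Lets one exhibited execution of a queue operation speak for every execution that a step of the
    algorithm may use. *)
Lemma exec_inj c m k1 m1 k2 m2 :
  exec c m k1 m1 -> exec c m k2 m2 -> k1 = k2 /\ m1 = m2.
Proof.
move=> H; elim: H k2 m2 => {c m k1 m1} [m|m x a|m x i a
  |c d m k m' l m'' _ IHc _ IHd|a b c d m k m' lt_ab _ IH|a b c d m k m' le_ba _ IH
  |a b c m k m' l m'' lt_ab _ IHc _ IHw|a b c m le_ba] k2 m2 H;
  inversion H; subst; try lia;
  repeat match goal with
  | IH : forall k m, exec ?c ?m0 k m -> _, X : exec ?c ?m0 _ _ |- _ =>
      have [? ?] := IH _ _ X; clear X; subst
  end; by [].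
Qed.

(** * Bucket queue *)

Section BucketQueue.
Local Open Scope nat_scope.

Definition clear (x i : nat) : cmd :=
  WhileLt (Lit 0) (Reg i)
    (Seq (Put x (Defs.Sub (Reg i) (Lit 1)) (Lit 0)) (Set_ i (Defs.Sub (Reg i) (Lit 1)))).

(* Register 2 holds the highest bucket that may be nonempty, and register 3 the
   next unused list node.  Arrays: 0 first node of a bucket, 1 next node, 2 key
   of a node, 3 priority of a key, or 0 if the key is not in the queue.  Changing
   the priority of a key leaves its old node in place, to be discarded when it
   is met. *)
Definition bucket_init : cmd :=
  Seq (Set_ 2 (Reg 1))
 (Seq (Set_ 3 (Lit 1))
 (Seq (Set_ 1 (Add (Reg 1) (Lit 1)))
 (Seq (clear 3 0) (clear 0 1)))).

Definition bucket_insert : cmd :=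
  Seq (Put 2 (Reg 3) (Reg 0))
 (Seq (Put 1 (Reg 3) (Get 0 (Reg 1)))
 (Seq (Put 0 (Reg 1) (Reg 3))
 (Seq (Put 3 (Reg 0) (Reg 1))
      (Set_ 3 (Add (Reg 3) (Lit 1)))))).

(** Register 4 is the loop guard. A hit sets it to 0; at an empty bucket it copies the lowered
    register 2, so it also reaches 0 when the buckets are exhausted. A node is stale if the recorded
    priority of its key is below the current bucket. *)
Definition bucket_search : cmd :=
  WhileLt (Lit 0) (Reg 4)
    (IfLt (Lit 0) (Get 0 (Reg 2))
       (Seq (Set_ 5 (Get 2 (Get 0 (Reg 2))))
       (Seq (Put 0 (Reg 2) (Get 1 (Get 0 (Reg 2))))
            (IfLt (Get 3 (Reg 5)) (Reg 2)
               Skip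
               (Seq (Set_ 0 (Add (Reg 5) (Lit 1)))
               (Seq (Put 3 (Reg 5) (Lit 0))
                    (Set_ 4 (Lit 0)))))))
       (Seq (Set_ 2 (Defs.Sub (Reg 2) (Lit 1)))
            (Set_ 4 (Reg 2)))).

Definition bucket_pop : cmd :=
  Seq (Set_ 0 (Lit 0)) (Seq (Set_ 4 (Reg 2)) bucket_search).

Definition bucket_queue := PQueue bucket_init bucket_insert bucket_pop.

Lemma clear_exec x i m : exists m', [/\
  exec (clear x i) m (13 * regs m i + 3) m',
  forall j, regs m' j = if j == i then 0 else regs m j &
  forall y j, arrs m' y j =
    if (y == x) && (j < regs m i) then 0 else arrs m y j].
Proof.
move eq_k: (regs m i) => k; elim: k m eq_k => [|k IH] m eq_k.
  exists m; split=> [|j|y j]; last by rewrite andbF.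
    by apply: ExecWhileF; rewrite /= eq_k.
  by case: eqP => // ->.
set m1 := set_reg (set_arr m x k 0) i k.
have [|m' [exec_m' regs_m' arrs_m']] := IH m1; first by rewrite /= /upd eqxx.
have eval1 m2 : regs m2 i = k.+1 -> eval m2 (Defs.Sub (Reg i) (Lit 1)) = k.
  by move=> /= ->; rewrite subSS subn0.
exists m'; split=> [|j|y j].
(* An iteration costs 10 for the body and 3 for the guard; the final 3 is the failing guard. *)
- have -> : 13 * k.+1 + 3 =
      (ecost (Lit 0) + ecost (Reg i) + 10 + (13 * k + 3)).+1 by rewrite /=; lia.
  apply: ExecWhileT exec_m'; first by rewrite /= eq_k.
  rewrite /m1 -{1}(eval1 m) // -(eval1 (set_arr m x (eval m (Defs.Sub (Reg i) (Lit 1))) 0)) //.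
  exact: ExecSeq (ExecPut _ _ _ (Lit 0)) (ExecSet _ _ _).
- by rewrite regs_m' /= /upd; case: (j == i).
- rewrite arrs_m' /= /upd; have [->|] //= := eqVneq y x.
  by rewrite ltnS; case: ltngtP.
Qed.

(** A linked list with 0 as null pointer, which is why allocation starts at 1. Its nodes lie below
    [cnt], so writing to the fresh node [cnt] cannot disturb it. *)
Fixpoint chain (cnt : nat) (nxt : nat -> nat) (h : nat) (l : seq nat) : bool :=
  if l is i :: l' then [&& h == i, 0 < i < cnt & chain cnt nxt (nxt i) l']
  else h == 0.

Lemma chain_upd cnt nxt h l a :
  chain cnt nxt h l -> chain cnt.+1 (upd nxt cnt a) h l.
Proof.
elim: l h => //= i l IH h /and3P[-> lt_i /IH].
by rewrite /upd; case: eqP => [|_ ->]; lia.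
Qed.

Lemma chain_lt cnt nxt h l i : chain cnt nxt h l -> i \in l -> i < cnt.
Proof.
elim: l h => //= j l IH h /and3P[_ /andP[_ ltj] /IH lt_l].
by rewrite inE => /orP[/eqP->|/lt_l].
Qed.

(* [P] gives the priorities, [c] bounds them, and [w] is the potential that pays
   for the remaining work of the searches. *)
Definition queue_inv (n : nat) (m : store) (P : nat -> nat) (c w : nat) : Prop :=
  exists L : nat -> seq nat,
    [/\ regs m 2 = c /\ 0 < regs m 3,
        forall x, x < n -> [/\ arrs m 3 x = P x, P x <= c &
          0 < P x -> exists2 i, i \in L (P x) & arrs m 2 i = x],
        forall b, 0 < b <= c -> chain (regs m 3) (arrs m 1) (arrs m 0 b) (L b),
        forall b i, 0 < b <= c -> i \in L b -> arrs m 2 i < n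
      & \sum_(b < c.+1) size (L b) + c <= w].

(** The memory is arbitrary at the start, so the [n] priorities and the heads of buckets 0 to [M]
    are cleared. The potential [M] pays for the later descent of the cursor. *)
Lemma bucket_initP (m : store) (n M : nat) : exists k m',
  [/\ call bucket_init m n M k m', k <= 60 * (n + M + 1) &
      queue_inv n m' (fun=> 0) M M].
Proof.
rewrite /call; set m0 := set_reg _ _ _.
set m1 := set_reg (set_reg (set_reg m0 2 M) 3 1) 1 (M + 1).
have [m2 [exec2 regs2 arrs2]] := clear_exec 3 0 m1.
have [m3 [exec3 regs3 arrs3]] := clear_exec 0 1 m2.
eexists; exists m3; split.
- do ![apply: ExecSeq; first exact: ExecSet].
  exact: ExecSeq exec2 exec3.
- by rewrite regs2 /= /upd /=; lia.
- exists (fun=> [::]); split.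
  + by rewrite !regs3 /= !regs2.
  + by move=> x lt_xn; rewrite arrs3 arrs2 /= lt_xn; split.
  + move=> b /andP[_ le_b] /=; rewrite arrs3 regs2 /= /upd /=.
    by rewrite addn1 ltnS le_b.
  + by [].
  + by rewrite big1.
Qed.

(** Since [p] does not exceed the cursor [c], the cursor never moves up; the potential grows only by
    the new node. *)
Lemma bucket_insertP (m : store) n P c w x p :
  x < n -> 0 < p <= c -> queue_inv n m P c w -> exists k m',
  [/\ call bucket_insert m x p k m', k <= 60 &
      queue_inv n m' (upd P x p) c w.+1].
Proof.
move=> lt_xn /andP[p_gt0 le_pc] [L [[Lr Lr'] LP Lc Lk Lw]]; rewrite /call.
eexists; eexists; split.
- by do ![apply: ExecSeq; first exact: ExecPut]; exact: ExecSet.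
- by [].
exists (upd L p (regs m 3 :: L p)); split.
- by rewrite /= /upd /= addn1.
- move=> y lt_yn; rewrite /= /upd /=; have [<-|ne_yx] := eqVneq y x.
    rewrite eqxx; split=> // _; exists (regs m 3); last by rewrite eqxx.
    by rewrite inE eqxx.
  have [-> le_Py inL] := LP y lt_yn; split=> // /[dup] P_gt0 /inL[i iL ix].
  exists i; first by case: eqP iL => // ->; rewrite inE => ->; rewrite orbT.
  (* An older node lies below the fresh one, so its key has not been overwritten. *)
  have /Lc/chain_lt/(_ iL) : 0 < P y <= c by rewrite P_gt0.
  by case: eqP => // ->; rewrite ltnn.
- move=> b b_c; rewrite /= /upd /= addn1.
  have [_|_] := eqVneq b p.
    rewrite /= ltnSn Lr' !eqxx /=; apply: chain_upd; apply: Lc.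
    by rewrite p_gt0.
  by apply: chain_upd; apply: Lc.
- move=> b i b_c iL; rewrite /= /upd /=; have [//|/eqP ne_i] := eqVneq i (regs m 3).
  apply: Lk b_c _; move: iL; rewrite /upd; have [->|//] := eqVneq b p.
  by rewrite inE => /predU1P[].
- have lt_p : p < c.+1 by [].
  rewrite (bigD1 (Ordinal lt_p)) //= {1}/upd eqxx /=.
  rewrite (bigD1 (Ordinal lt_p)) //= in Lw.
  rewrite (eq_bigr (fun b : 'I_c.+1 => size (L b))) ?addSn ?ltnS // => b.
  by rewrite /upd -(inj_eq val_inj) /= => /negPf->.
Qed.

(** Each iteration removes a node or lowers the cursor, and so releases one unit of [w], worth 60
    time units. *)
Lemma bucket_searchP (m : store) n P c w :
  queue_inv n m P c w -> regs m 0 = 0 -> regs m 4 = c -> exists k m',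
  exec bucket_search m k m' /\
  ([/\ k <= 60 + 60 * w, regs m' 0 = 0 & forall x, x < n -> P x = 0] \/
   exists x w', [/\ k + 60 * w' <= 60 + 60 * w, regs m' 0 = x.+1, x < n,
     0 < P x /\ forall y, y < n -> P y <= P x &
     queue_inv n m' (upd P x 0) (P x) w']).
Proof.
elim: w m c => [|w IH] m c inv_m reg0 reg4;
  have [L [[Lr Lr'] LP Lc Lk Lw]] := inv_m.
all: have [c0|c_gt0] := posnP c;
  first (exists 3, m; split; [by apply: ExecWhileF; rewrite /= reg4 c0|left; split=> //];
    by move=> x lt_xn; have [_] := LP x lt_xn; lia).
  by move: Lw; lia.
have c_le : 0 < c <= c by rewrite c_gt0 leqnn.
have chain_c := Lc c c_le.
case eq_L: (L c) (chain_c) => [|i l] /=.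
  move=> /eqP head0.
  case: c c_gt0 Lr LP Lc Lk Lw c_le chain_c eq_L head0 reg4 inv_m => // c _.
  move=> Lr LP Lc Lk Lw c_le chain_c eq_L head0 reg4 inv_m.
  set m1 := set_reg (set_reg m 2 c) 4 c.
  have step1 : exec (Seq (Set_ 2 (Defs.Sub (Reg 2) (Lit 1))) (Set_ 4 (Reg 2))) m 7 m1.
    have -> : m1 = set_reg (set_reg m 2 (eval m (Defs.Sub (Reg 2) (Lit 1)))) 4
       (eval (set_reg m 2 (eval m (Defs.Sub (Reg 2) (Lit 1)))) (Reg 2)).
      by rewrite /= Lr subSS subn0.
    exact: (ExecSeq (ExecSet _ _ _) (ExecSet _ _ _)).
  have [|k [m' [exec_m' post]]] := IH m1 c _ reg0 erefl.
    exists L; split=> //=.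
    (* A key of priority [c.+1] would own a node in bucket [c.+1], which is empty; hence [c] bounds
       all priorities. *)
    + move=> x lt_xn; have [-> le_P inL] := LP x lt_xn; split=> //.
      move: le_P; rewrite leq_eqVlt => /predU1P[eqP|//].
      by case: inL => [|j]; rewrite eqP // eq_L.
    + by move=> b /andP[? ?]; apply: Lc; lia.
    + by move=> b j /andP[? ?]; apply: Lk; lia.
    + by move: Lw; rewrite big_ord_recr /= eq_L /=; lia.
  eexists; exists m'; split.
    apply: ExecWhileT exec_m'; first by rewrite /= reg4.
    by apply: ExecIfF step1; rewrite /= Lr head0.
  rewrite /=; case: post => [[le_k reg0' P0]|[x [w' [le_k reg0' lt_xn Pmax inv']]]].
    by left; split=> //; lia.
  by right; exists x, w'; split=> //; lia.
case/and3P=> /eqP head_c /andP[i_gt0 lt_i] chain_l.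
have key_i : arrs m 2 i < n by apply: Lk c_le _; rewrite eq_L inE eqxx.
have [eq_P le_P inL] := LP _ key_i.
set m1 := set_arr (set_reg m 5 (arrs m 2 i)) 0 c (arrs m 1 i).
have exec1 d k m' : exec d m1 k m' ->
    exec (Seq (Set_ 5 (Get 2 (Get 0 (Reg 2))))
       (Seq (Put 0 (Reg 2) (Get 1 (Get 0 (Reg 2)))) d)) m (4 + (5 + k).+1).+1 m'.
  move=> exec_d; apply: ExecSeq; first exact: ExecSet.
  set m2 := set_reg _ _ _; apply: ExecSeq; first exact: ExecPut.
  have -> : set_arr m2 0 (eval m2 (Reg 2)) (eval m2 (Get 1 (Get 0 (Reg 2)))) = m1.
    by rewrite /m2 /= /upd /= Lr head_c.
  exact: exec_d.
have L1 b j : j \in upd L c l b -> j \in L b.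
  by rewrite /upd; case: eqP => // ->; rewrite eq_L inE => ->; rewrite orbT.
have chain1 b : 0 < b <= c ->
    chain (regs m 3) (arrs m 1) (upd (arrs m 0) c (arrs m 1 i) b) (upd L c l b).
  by rewrite /upd => b_c; case: eqP => // _; apply: Lc.
have size1 : \sum_(b < c.+1) size (upd L c l b) + c <= w.
  have eqS : \sum_(b < c) size (upd L c l b) = \sum_(b < c) size (L b).
    by apply: eq_bigr => b _; rewrite /upd ltn_eqF.
  by move: Lw; rewrite !big_ord_recr /= eqS /upd eqxx eq_L /= addnS.
have inL1 x : x < n -> x != arrs m 2 i -> 0 < P x ->
    exists2 j, j \in upd L c l (P x) & arrs m 2 j = x.
  move=> lt_xn ne_x P_gt0; have [_ _ /(_ P_gt0)[j jL eqj]] := LP x lt_xn.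
  exists j => //; rewrite /upd; case: eqP => // eqc.
  move: jL; rewrite eqc eq_L inE => /predU1P[eq_j|//].
  by rewrite -eqj eq_j eqxx in ne_x.
(* If the key of a stale node is still queued, its valid node lies in a lower bucket and survives
   the removal. *)
have [stale|live] := ltnP (P (arrs m 2 i)) c.
  have [|k [m' [exec_m' post]]] := IH m1 c _ reg0 reg4.
    exists (upd L c l); split=> //=.
    + move=> x lt_xn; have [eqx lePx inLx] := LP x lt_xn; split=> // P_gt0.
      have [eq_x|ne_x] := eqVneq x (arrs m 2 i); last exact: inL1.
      have [j jL eqj] := inLx P_gt0; exists j => //.
      by rewrite /upd eq_x ltn_eqF // -eq_x.
    + by move=> b j b_c /L1; apply: Lk.
  eexists; exists m'; split.
    apply: ExecWhileT exec_m'; first by rewrite /= reg4.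
    apply: ExecIfT; first by rewrite /= Lr head_c.
    apply: exec1; apply: ExecIfT (ExecSkip _).
    by rewrite /= /upd /= eq_P Lr.
  rewrite /=; case: post => [[le_k reg0' P0]|[x [w' [le_k reg0' lt_xn Pmax inv']]]].
    by left; split=> //; lia.
  by right; exists x, w'; split=> //; lia.
have eqc : P (arrs m 2 i) = c by apply/eqP; rewrite eqn_leq le_P.
eexists; eexists; split.
  apply: (@ExecWhileT _ _ _ _ _ _ 3); first by rewrite /= reg4.
    apply: ExecIfT; first by rewrite /= Lr head_c.
    apply: exec1; apply: ExecIfF; first by rewrite /= /upd /= eq_P Lr.
    apply: ExecSeq; first exact: ExecSet.
    apply: ExecSeq; first exact: ExecPut.
    exact: ExecSet.
  exact: ExecWhileF.
right; exists (arrs m 2 i), w; split=> //=.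
- by lia.
- by rewrite /upd /= addn1.
- by rewrite eqc; split=> // y lt_yn; have [] := LP y lt_yn.
rewrite eqc; exists (upd L c l); split=> //=.
+ move=> x lt_xn; have [eqx lePx _] := LP x lt_xn.
  rewrite /upd /=; have [//|ne_x] := eqVneq x (arrs m 2 i).
  by split=> //; apply: inL1.
+ by move=> b j b_c /L1; apply: Lk.
Qed.

Lemma bucket_popP (m : store) n P c w :
  queue_inv n m P c w -> exists k m',
  call bucket_pop m 0 0 k m' /\
  ([/\ k <= 70 + 60 * w, regs m' 0 = 0 & forall x, x < n -> P x = 0] \/
   exists x w', [/\ k + 60 * w' <= 70 + 60 * w, regs m' 0 = x.+1, x < n,
     0 < P x /\ forall y, y < n -> P y <= P x &
     queue_inv n m' (upd P x 0) (P x) w']).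
Proof.
move=> [L [[Lr Lr'] LP Lc Lk Lw]].
set m0 := set_reg (set_reg m 0 0) 1 0.
set m1 := set_reg (set_reg m0 0 0) 4 c.
have [|//|//|k [m' [exec_m' post]]] := @bucket_searchP m1 n P c w.
  by exists L; split.
eexists; exists m'; split.
  do ![apply: ExecSeq; first exact: ExecSet].
  by rewrite /= /upd /= Lr; exact: exec_m'.
rewrite /=; case: post => [[le_k reg0' P0]|[x [w' [le_k reg0' lt_xn Pmax inv']]]].
  by left; split=> //; lia.
by right; exists x, w'; split=> //; lia.
Qed.

End BucketQueue.

(** * Eulerian subgraphs, agony and slack *)

Section EulerianSubgraphs.
Variable V : finType.
Notation edge := (V * V)%type.
Implicit Types (e : edge) (E F H O : {set edge}) (r : {ffun V -> int}).

(** Out-degree minus in-degree, as a sum over edges so that adding or deleting one edge changes it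
    by an explicit term. *)
Definition excess F (v : V) : int :=
  \sum_(e in F) ((e.1 == v)%:R - (e.2 == v)%:R).

Lemma eulerianP F : reflect (forall v, excess F v = 0) (eulerian F).
Proof.
have excessE v : excess F v =
    #|[set e in F | e.1 == v]|%:R - #|[set e in F | e.2 == v]|%:R.
  rewrite /excess sumrB -!sum1_card !natr_sum; congr (_ - _).
    rewrite (big_mkcond (fun e => e \in [set _ in _ | _])) [LHS]big_mkcond.
    by apply: eq_bigr => e _; rewrite inE; case: (e \in F); case: (_ == v).
  rewrite (big_mkcond (fun e => e \in [set _ in _ | _])) [LHS]big_mkcond.
  by apply: eq_bigr => e _; rewrite inE; case: (e \in F); case: (_ == v).
apply: (iffP forallP) => euF v; have := euF v; rewrite excessE.
  by move=> /eqP ->; rewrite subrr.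
by move=> /eqP; rewrite subr_eq0 eqr_nat eq_sym.
Qed.

Lemma sum_rank_diff F r :
  \sum_(e in F) (r e.1 - r e.2) = \sum_v r v * excess F v.
Proof.
under [RHS]eq_bigr do rewrite /excess big_distrr /=.
rewrite exchange_big /=; apply: eq_bigr => e _.
under eq_bigr do rewrite mulrBr.
have pickE w : \sum_v r v * (w == v)%:R = r w.
  rewrite (bigD1 w) //= eqxx mulr1 big1 ?addr0 // => v ne_v.
  by rewrite eq_sym (negPf ne_v) mulr0.
by rewrite sumrB !pickE.
Qed.

(** Edges outside [H] are forward and have no agony. On [H], agony is the rank difference plus 1
    plus the slack, and the rank differences cancel because every excess is 0. *)
Lemma agony_eulerian E H r : H \subset E -> eulerian H -> conforms E H r ->
  agony E r = #|H|%:R + \sum_(e in H) slack e r.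
Proof.
move=> sHE /eulerianP euH confH.
rewrite /agony (bigID (mem H)) /= [X in _ + X]big1 ?addr0 => [|e /andP[eE eH]].
  rewrite (eq_bigl (mem H)) => [|e]; last first.
    by rewrite andb_idl //; apply: (subsetP sHE).
  transitivity (\sum_(e in H) (r e.1 - r e.2 + (1 + slack e r))).
    by apply: eq_bigr => e _; rewrite /edge_agony /slack; lia.
  rewrite !big_split /= -big_split /= sum_rank_diff sumr_const.
  by rewrite big1 ?add0r // => v _; rewrite euH mulr0.
have := contra (confH e eE) eH; rewrite /backward /edge_agony; lia.
Qed.

Lemma excess_setD1 F e v : e \in F ->
  excess (F :\ e) v = excess F v - ((e.1 == v)%:R - (e.2 == v)%:R).
Proof. by move=> eF; rewrite /excess [in RHS](big_setD1 e) //= addrC addrK. Qed.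

Lemma excess_setU1 F e v : e \notin F ->
  excess (e |: F) v = excess F v + ((e.1 == v)%:R - (e.2 == v)%:R).
Proof. by move=> eF; rewrite /excess big_setU1 //= addrC. Qed.

Definition flip F O := (F :\: O) :|: (O :\: F).

Lemma flip_in F O e : e \notin O -> e \in F -> flip F (e |: O) = flip F O :\ e.
Proof.
move=> /negPf eO eF; apply/setP=> e'; rewrite !inE.
have [->|] /= := eqVneq e' e; first by rewrite eF.
by [].
Qed.

Lemma flip_notin F O e :
  e \notin O -> e \notin F -> flip F (e |: O) = e |: flip F O.
Proof.
move=> /negPf eO /negPf eF; apply/setP=> e'; rewrite !inE.
by have [->|] /= := eqVneq e' e; rewrite ?eF ?eO.
Qed.

End EulerianSubgraphs.

(** * Invariants of Relief *)

Section Relief.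
Variables (V : finType) (E : {set V * V}).
Notation edge := (V * V)%type.
Implicit Types (e : edge) (F H A B O : {set edge}) (r : {ffun V -> int}).
Implicit Types (f : frame V) (D : seq V) (u v x y : V) (c : nat).

Definition good H r : Prop :=
  [/\ H \subset E, eulerian H, conforms E H r &
      forall e, e \in H -> slack e r <= #|E|%:Z].

Definition num_slack H r : nat := #|[set e in H | 0 < slack e r]|.

(** The rank of [v] after its pop, or the rank it would get if popped with its present priority. *)
Definition final_rank f v : int := fr f v + ft f v.

(** The two kinds of parent edge. Flipping adds the first kind, which is tight and thus has slack 0,
    and deletes the second, which is forward, so conformity survives. *)
Definition link f y v e : Prop :=
  [/\ e = (y, v), e \notin fF f & final_rank f v = final_rank f y + 1] \/
  [/\ e = (v, y), e \in fF f & final_rank f v + 1 <= final_rank f y].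

(* [D] lists the vertices popped so far, oldest first; [A] and [B] are the edges
   at the last of them that remain to be examined.  The priorities are at least
   [c] on [D] and at most [c] in the queue. *)
Record frame_inv f D A B c : Prop := FrameInv {
  inv_good : good (fF f) (fr f);
  inv_ps : fps f \in fF f;
  inv_slack : 0 < slack (fps f) (fr f);
  inv_uniq : uniq D;
  inv_rank v : fr' f v = if v \in D then final_rank f v else fr f v;
  inv_popped v : v \in D -> c%:Z <= ft f v;
  inv_queued v : v \in fS f -> [/\ v \notin D, 0 < ft f v & ft f v <= c%:Z];
  inv_fresh v : v \notin D -> v \notin fS f -> ft f v = 0;
  inv_top : ft f (fps f).1 = slack (fps f) (fr f);
  inv_root : D = [::] /\ fS f = [set (fps f).1] \/ (fps f).1 \in D;
  inv_parent v : v != (fps f).1 -> (v \in D) || (v \in fS f) ->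
    exists y e, [/\ fpar f v = Some (y, e), (index y D < index v D)%N, e \in E &
      link f y v e];
  inv_out e : e \in E -> e.1 \in D -> e \notin fF f -> e \notin A ->
    final_rank f e.1 + 1 <= final_rank f e.2;
  inv_in e : e \in fF f -> e.2 \in D -> e \notin B ->
    final_rank f e.2 - final_rank f e.1 - 1 <= slack e (fr f) }.

Lemma forward_notin H r e : good H r -> e \in E -> e \notin H -> r e.1 < r e.2.
Proof. by move=> [_ _ confH _] eE /(contra (confH e eE)); rewrite -ltNge. Qed.

Lemma inv_t_ge0 f D A B c v : frame_inv f D A B c -> 0 <= ft f v.
Proof.
move=> inv_f; have [/(inv_popped inv_f)|vD] := boolP (v \in D); first by lia.
have [/(inv_queued inv_f)[]|vS] := boolP (v \in fS f); first by lia.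
by rewrite (inv_fresh inv_f).
Qed.

Lemma relief_init_inv H r e : good H r -> e \in H -> 0 < slack e r ->
  frame_inv (relief_init H r e) [::] set0 set0 #|E|.
Proof.
move=> goodH eH slack_e.
have slackE : r e.2 - r e.1 - 1 = slack e r by move: slack_e; rewrite /slack; lia.
split=> //=.
- move=> v; rewrite !inE ffunE => /eqP->; rewrite eqxx slackE; split=> //.
  by have [_ _ _] := goodH; apply.
- by move=> v _; rewrite !inE ffunE => /negPf->.
- by rewrite ffunE eqxx.
- by left.
- by move=> v /negPf ne_v; rewrite inE ne_v.
Qed.

(** The popped priority is a maximum of the queue and at most [c], so it separates the popped
    vertices from the queued ones. All edges at [u] become unexamined, which makes the edge clauses
    vacuous for [u]. *)
Lemma raise_inv f D c u :
  frame_inv f D set0 set0 c -> u \in fS f ->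
  (forall v, v \in fS f -> ft f v <= ft f u) ->
  frame_inv (raise f u) (rcons D u) [set e in E | e.1 == u] [set e in E | e.2 == u]
    `|ft f u|%N.
Proof.
move=> inv_f uS max_u; have [uD t_gt0 le_t] := inv_queued inv_f uS.
have abs_t : (`|ft f u|%N)%:Z = ft f u by lia.
(* A vertex outside [D] has index [size D], so a queued vertex counts as later than every popped
   one. *)
have index_rcons x y : (index x D < index y D)%N ->
    (index x (rcons D u) < index y (rcons D u))%N.
  move=> lt_xy; have xD : x \in D.
    by rewrite -index_mem; apply: leq_trans lt_xy _; apply: index_size.
  rewrite -!cats1 !index_cat xD; case: ifP => // yD.
  by apply: leq_trans (leq_addr _ _); rewrite index_mem.
case: (inv_f) => good_f psF slack_ps uniqD rankD popped queued fresh top root par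
  out_ok in_ok.
split=> //=.
- by rewrite rcons_uniq uD.
- move=> v; rewrite ffunE mem_rcons inE rankD.
  have [->|ne_v] /= := eqVneq v u; last by rewrite rankD.
  by rewrite (negPf uD).
- move=> v; rewrite abs_t mem_rcons inE => /predU1P[->//|/popped]; lia.
- move=> v; rewrite abs_t mem_rcons !inE => /andP[ne_v vS].
  have [vD gt0 _] := queued v vS.
  by rewrite (negPf ne_v) vD; split=> //; apply: max_u.
- move=> v; rewrite mem_rcons !inE negb_or => /andP[ne_v vD].
  by rewrite ne_v; apply: fresh.
- right; rewrite mem_rcons inE; case: root => [[_ eqS]|->]; last by rewrite orbT.
  by move: uS; rewrite eqS inE eq_sym => ->.
- move=> v ne_v; rewrite mem_rcons !inE => vDS.
  have [|y [e [eq_par lt_yv eE le]]] := par v ne_v; last first.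
    by exists y, e; split=> //; apply: index_rcons.
  by have [->|] := eqVneq v u; rewrite ?uS ?orbT //; move: vDS; case: eqP.
- move=> e eE; rewrite mem_rcons !inE eE /= => + eF /negPf ne.
  by rewrite ne => /= eD; apply: out_ok; rewrite ?inE.
- move=> e eF; have eE : e \in E by case: good_f => /subsetP/(_ e eF).
  rewrite mem_rcons !inE eE /= => + /negPf ne.
  by rewrite ne => /= eD; apply: in_ok; rewrite ?inE.
Qed.

(** Only the final rank of the unpopped [v] changes, and it rises. The edge clauses fix the endpoint
    in [D] and can only gain from a rise at the other one; existing links have their parent in
    [D]. *)
Lemma enqueue_inv f D A B c v t u e :
  frame_inv f D A B c -> u \in D -> v \notin D -> e \in E ->
  ft f v < t <= c%:Z ->
  [\/ [/\ e = (u, v), e \notin fF f & fr f v + t = final_rank f u + 1] |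
      [/\ e = (v, u), e \in fF f & fr f v + t + 1 <= final_rank f u]] ->
  frame_inv (enqueue f v t u e) D A B c.
Proof.
move=> inv_f uD vD eE /andP[lt_t le_t] link_e.
have t_ge0 := inv_t_ge0 v inv_f.
case: (inv_f) => good_f psF slack_ps uniqD rankD popped queued fresh top root par
  out_ok in_ok.
have pD : (fps f).1 \in D by case: root uD => [[-> _]|].
have neD x : x \in D -> x != v by apply: contraTneq => ->.
have rankE x : final_rank (enqueue f v t u e) x =
    if x == v then fr f v + t else final_rank f x.
  by rewrite /final_rank /= ffunE; case: eqP => [->|].
have rankED x : x \in D -> final_rank (enqueue f v t u e) x = final_rank f x.
  by move=> /neD/negPf ne; rewrite rankE ne.
have le_rank x : final_rank f x <= final_rank (enqueue f v t u e) x.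
  by rewrite rankE; case: eqP => [->|//]; rewrite /final_rank; lia.
split=> //=.
- by move=> x; rewrite rankD; case: ifP => // xD; rewrite rankED.
- by move=> x xD; rewrite ffunE (negPf (neD x xD)); apply: popped.
- move=> x; rewrite !inE ffunE; have [->|ne_x] /= := eqVneq x v.
    by move=> _; split=> //; lia.
  exact: queued.
- move=> x xD; rewrite !inE ffunE negb_or => /andP[/negPf-> /=].
  exact: fresh.
- by rewrite ffunE (negPf (neD _ pD)).
- by right.
- move=> x ne_x; rewrite ffunE !inE; have [eq_x _|ne_xv] := eqVneq x v.
    exists u, e; split=> //; first by rewrite eq_x (memNindex vD) index_mem.
    rewrite /link !rankE eq_x eqxx (negPf (neD u uD)) /=.
    by case: link_e => [[? ? ?]|[? ? ?]]; [left|right].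
  move=> /= /(par x ne_x)[y [e' [eq_par lt_yx e'E le]]].
  exists y, e'; split=> //; move: le.
  have yD : y \in D.
    by rewrite -index_mem; apply: leq_trans lt_yx _; apply: index_size.
  by rewrite /link !rankE (negPf ne_xv) (negPf (neD y yD)).
- move=> e' e'E e'D e'F e'A; rewrite (rankED _ e'D).
  exact: le_trans (out_ok e' e'E e'D e'F e'A) (le_rank _).
- move=> e' e'F e'D e'B; rewrite (rankED _ e'D).
  apply: le_trans (in_ok e' e'F e'D e'B).
  by have := le_rank e'.1; lia.
Qed.

Lemma drop_out_inv f D A B c e : frame_inv f D A B c ->
  (e \notin fF f -> final_rank f e.1 + 1 <= final_rank f e.2) ->
  frame_inv f D (A :\ e) B c.
Proof.
case=> good_f psF slack_ps uniqD rankD popped queued fresh top root par out_ok in_ok ok.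
split=> // e' e'E e'D e'F; rewrite !inE negb_and negbK => /orP[/eqP eq_e|].
  by rewrite eq_e in e'F *; apply: ok.
exact: out_ok.
Qed.

Lemma drop_in_inv f D A B c e : frame_inv f D A B c ->
  (e \in fF f -> final_rank f e.2 - final_rank f e.1 - 1 <= slack e (fr f)) ->
  frame_inv f D A (B :\ e) c.
Proof.
case=> good_f psF slack_ps uniqD rankD popped queued fresh top root par out_ok in_ok ok.
split=> // e' e'F e'D; rewrite !inE negb_and negbK => /orP[/eqP eq_e|].
  by rewrite eq_e in e'F *; apply: ok.
exact: in_ok.
Qed.

(** A popped head has risen at least as much as [u], so the edge stays forward. For an unpopped
    head, the failed test says that its rank plus its priority is already high enough. *)
Lemma scan_out_skip_inv f D A B c u e :
  frame_inv f D A B c -> u \in D -> ft f u = c%:Z -> e \in E -> e.1 = u ->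
  ~~ out_relaxes f e -> frame_inv f D (A :\ e) B c.
Proof.
move=> inv_f uD t_u eE e1 norelax; apply: (drop_out_inv inv_f) => eF.
have lt_r := forward_notin (inv_good inv_f) eE eF.
move: norelax; rewrite /out_relaxes /out_gain eF /= !(inv_rank inv_f) e1 uD.
rewrite e1 in lt_r; rewrite /final_rank.
case: ifP => [/(inv_popped inv_f)|_]; first by lia.
have := inv_t_ge0 e.2 inv_f; lia.
Qed.

(** The edge is forward in the old ranks, so an unpopped head is offered at most the priority of
    [u], while a popped head has risen enough not to relax. Hence no vertex returns to the queue
    after its pop. *)
Lemma scan_out_inv f D A B c u e :
  frame_inv f D A B c -> u \in D -> ft f u = c%:Z -> e \in E -> e.1 = u ->
  out_relaxes f e ->
  e.2 \notin D /\
  frame_inv (enqueue f e.2 (out_gain f e) u e) D (A :\ e) B c.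
Proof.
move=> inv_f uD t_u eE e1 /and3P[eF].
have lt_r := forward_notin (inv_good inv_f) eE eF.
have t_ge0 := inv_t_ge0 e.2 inv_f.
rewrite /out_gain !(inv_rank inv_f) e1 uD; rewrite e1 in lt_r; rewrite /final_rank.
case: ifP => [/(inv_popped inv_f)|/negbT vD le_r lt_t]; first by lia.
split=> //; apply: drop_out_inv.
  apply: enqueue_inv => //; first by lia.
  left; split; first by rewrite -e1; case: (e).
    by [].
  by rewrite /final_rank; lia.
move=> _; rewrite /final_rank /= !ffunE eqxx e1.
case: eqP => [eq_u|_]; last by lia.
by rewrite -eq_u uD in vD.
Qed.

Lemma slack_ge0 e r : 0 <= slack e r.
Proof. by rewrite /slack; lia. Qed.

Lemma scan_in_skip_inv f D A B c u e :
  frame_inv f D A B c -> u \in D -> ft f u = c%:Z -> e.2 = u ->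
  ~~ in_relaxes f e -> frame_inv f D A (B :\ e) c.
Proof.
move=> inv_f uD t_u e2 norelax; apply: (drop_in_inv inv_f) => eF.
move: norelax; rewrite /in_relaxes /in_gain eF /= /slack !(inv_rank inv_f) e2 uD.
rewrite /final_rank.
case: ifP => [/(inv_popped inv_f)|_]; first by lia.
have := inv_t_ge0 e.1 inv_f; lia.
Qed.

(** Slack grows by at most the rise of the head minus the rise of the tail: not at all if the tail
    was popped, and by at most the priority of [u] otherwise. *)
Lemma scan_in_inv f D A B c u e :
  frame_inv f D A B c -> u \in D -> ft f u = c%:Z -> e.2 = u ->
  in_relaxes f e ->
  e.1 \notin D /\
  frame_inv (enqueue f e.1 (in_gain f e) u e) D A (B :\ e) c.
Proof.
move=> inv_f uD t_u e2 /and3P[eF].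
have eE : e \in E by case: (inv_good inv_f) => /subsetP/(_ e eF).
have t_ge0 := inv_t_ge0 e.1 inv_f.
rewrite /in_gain /slack !(inv_rank inv_f) e2 uD /final_rank.
case: ifP => [/(inv_popped inv_f)|/negbT vD le_r lt_t]; first by lia.
split=> //; apply: drop_in_inv.
  apply: enqueue_inv => //; first by lia.
  right; split; first by rewrite -e2; case: (e).
    by [].
  by rewrite /final_rank; lia.
move=> _; rewrite /final_rank /= !ffunE eqxx e2.
case: eqP => [eq_u|_]; last by rewrite /slack e2; lia.
by rewrite -eq_u uD in vD.
Qed.

(** * The outcome of one call of Relief *)

Section ReliefEnd.
Variables (f : frame V) (D : seq V) (c : nat).
Hypotheses (inv_f : frame_inv f D set0 set0 c) (S0 : fS f = set0).

Lemma end_rank v : fr' f v = final_rank f v.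
Proof.
rewrite (inv_rank inv_f); case: ifP => // /negbT vD.
by rewrite /final_rank (inv_fresh inv_f) ?addr0 // S0 inE.
Qed.

Lemma end_rank_ge v : fr f v <= fr' f v.
Proof. by rewrite end_rank /final_rank lerDl (inv_t_ge0 v inv_f). Qed.

Lemma end_rank_unpopped v : v \notin D -> fr' f v = fr f v.
Proof. by rewrite (inv_rank inv_f) => /negPf->. Qed.

Lemma end_forward e : e \in E -> e \notin fF f -> fr' f e.1 < fr' f e.2.
Proof.
move=> eE eF; have [eD|eD] := boolP (e.1 \in D).
  by have := inv_out inv_f eE eD eF; rewrite inE !end_rank => /(_ isT); lia.
have := forward_notin (inv_good inv_f) eE eF.
by rewrite end_rank_unpopped //; have := end_rank_ge e.2; lia.
Qed.

Lemma end_slack e : e \in fF f -> slack e (fr' f) <= slack e (fr f).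
Proof.
move=> eF; have [eD|eD] := boolP (e.2 \in D).
  have := inv_in inv_f eF eD; rewrite inE -!end_rank => /(_ isT).
  by rewrite /slack; lia.
by rewrite /slack (end_rank_unpopped eD); have := end_rank_ge e.1; lia.
Qed.

(** Slacks on the old subgraph never grew, so each edge of [F'] with positive slack was already
    counted, and [fps f] was counted but no longer is. The same comparison carries the bound [#|E|]
    over. *)
Lemma end_good F' :
  F' \subset E -> eulerian F' ->
  (forall e, e \in E -> e \notin F' -> fr' f e.1 < fr' f e.2) ->
  (forall e, e \in F' -> 0 < slack e (fr' f) -> (e \in fF f) && (e != fps f)) ->
  good F' (fr' f) /\ (num_slack F' (fr' f) < num_slack (fF f) (fr f))%N.
Proof.
move=> sF'E euF' fwd pos; split.
  split=> // [e eE|e eF'].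
    by apply: contraTT => /(fwd e eE); rewrite /backward -ltNge.
  have [le0|gt0] := leP (slack e (fr' f)) 0; first by lia.
  have /andP[eF _] := pos e eF' gt0; apply: le_trans (end_slack eF) _.
  by case: (inv_good inv_f) => _ _ _; apply.
rewrite /num_slack [X in (_ < X)%N](cardsD1 (fps f)) inE (inv_ps inv_f).
rewrite (inv_slack inv_f) ltnS; apply/subset_leq_card/subsetP=> e.
rewrite !inE => /andP[eF' gt0]; have /andP[eF ->] := pos e eF' gt0.
by rewrite eF (lt_le_trans gt0 (end_slack eF)).
Qed.

Lemma end_keep : slack (fps f) (fr' f) <= 0 ->
  good (fF f) (fr' f) /\ (num_slack (fF f) (fr' f) < num_slack (fF f) (fr f))%N.
Proof.
move=> slack0; have [sFE euF _ _] := inv_good inv_f.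
apply: end_good => // [e|e eF gt0]; first exact: end_forward.
by rewrite eF; apply: contraTneq gt0 => ->; rewrite -leNgt.
Qed.

(** Flipping the path walked so far unbalances the subgraph only by one surplus out-edge at [x] and
    one surplus in-edge at s. The clause on indices guarantees that the next edge of the walk is
    new. *)
Definition walk_inv x O : Prop :=
  [/\ x \in D, O \subset E,
      forall e, e \in O -> [/\ e != fps f,
        (index x D < maxn (index e.1 D) (index e.2 D))%N,
        e \in fF f -> fr' f e.1 < fr' f e.2 &
        e \notin fF f -> fr' f e.2 = fr' f e.1 + 1] &
      forall v, excess (flip (fF f) O) v = (x == v)%:R - ((fps f).2 == v)%:R].

Lemma walk_start : 0 < slack (fps f) (fr' f) -> walk_inv (fps f).2 set0.
Proof.
move=> slack_gt0; split; last 3 first.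
- exact: sub0set.
- by move=> e; rewrite inE.
- have [_ /eulerianP euF _ _] := inv_good inv_f.
  by move=> v; rewrite /flip setD0 set0D setU0 euF subrr.
(* If s was never popped it kept its rank, while p rose by the whole slack of (p, s), which leaves
   slack 0. *)
apply: contraTT slack_gt0 => /end_rank_unpopped eq2.
rewrite -leNgt /slack eq2 end_rank /final_rank (inv_top inv_f).
by rewrite /slack; lia.
Qed.

(** A parent is popped before its child, so the walk descends in [D] and terminates. Adding an edge
    from [y] to [x] and deleting one from [x] to [y] both move the surplus from [x] to [y]. *)
Lemma walk_step x O : walk_inv x O -> x != (fps f).1 ->
  exists y e, [/\ fpar f x = Some (y, e), walk_inv y (e |: O) &
    (index y D < index x D)%N].
Proof.
move=> [xD sOE O_ok exO] ne_x.
have [|y [e [eq_par lt_yx eE link_e]]] := inv_parent inv_f ne_x; first by rewrite xD.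
exists y, e; split=> //.
have max_e : maxn (index e.1 D) (index e.2 D) = index x D.
  by case: link_e => [[-> _ _]|[-> _ _]] /=; lia.
have eO : e \notin O.
  by apply/negP => /O_ok[_]; rewrite max_e ltnn.
split.
- by rewrite -index_mem; apply: leq_trans lt_yx _; apply: index_size.
- by apply/subsetP=> e'; rewrite !inE => /predU1P[->//|/(subsetP sOE)].
- move=> e'; rewrite !inE => /predU1P[->|/O_ok[? ? ? ?]]; last by split=> //; lia.
  rewrite max_e; move: link_e; rewrite /link -!end_rank.
  case=> [[eq_e eF eqr]|[eq_e eF ler]]; split=> //.
  (* The walk avoids (p, s): that edge lies in [fF f], and a link of the second kind starts at [x],
     which differs from p. *)
  + by apply: contraNneq eF => ->; apply: (inv_ps inv_f).
  + by rewrite (negPf eF).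
  + by rewrite eq_e.
  + by apply: contraNneq ne_x => <-; rewrite eq_e.
  + by move=> _; rewrite eq_e /=; lia.
  + by rewrite eF.
- move=> v; case: link_e => [[eq_e eF _]|[eq_e eF _]].
    rewrite flip_notin // excess_setU1 ?exO ?eq_e /=; first by lia.
    by rewrite -eq_e !inE (negPf eF) (negPf eO).
  rewrite flip_in // excess_setD1 ?exO ?eq_e /=; first by lia.
  by rewrite -eq_e !inE eF eO.
Qed.

(** At p the remaining imbalance is exactly that of the edge (p, s), so deleting it restores
    balance; its positive slack makes it forward, so conformity is kept. *)
Lemma walk_end O : walk_inv (fps f).1 O -> 0 < slack (fps f) (fr' f) ->
  good (flip (fF f) O :\ fps f) (fr' f) /\
  (num_slack (flip (fF f) O :\ fps f) (fr' f) < num_slack (fF f) (fr f))%N.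
Proof.
move=> [_ sOE O_ok exO] slack_gt0; have [sFE _ _ _] := inv_good inv_f.
have psO : fps f \notin O by apply/negP => /O_ok[]; rewrite eqxx.
apply: end_good.
- apply/subsetP=> e; rewrite !inE => /andP[_ /orP[]] /andP[_].
    exact: (subsetP sFE).
  exact: (subsetP sOE).
- apply/eulerianP=> v; rewrite excess_setD1 ?exO ?subrr //.
  by rewrite !inE psO (inv_ps inv_f).
- move=> e eE; rewrite !inE negb_and negbK => /predU1P[->|].
    by move: slack_gt0; rewrite /slack; lia.
  have [eO|eO] := boolP (e \in O); have [eF|eF] /= := boolP (e \in fF f) => //.
    by move=> _; have [_ _ /(_ eF)] := O_ok e eO.
  by move=> _; apply: end_forward.
- move=> e; rewrite !inE => /andP[-> /orP[/andP[_ ->]//|/andP[eF eO]]].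
  have [_ _ _ /(_ eF) eqr] := O_ok e eO.
  by rewrite /slack eqr; lia.
Qed.

End ReliefEnd.

End Relief.
(** * Potentials *)

(** Every step costs at least one unit, so induction on the remaining budget gives termination
    together with the time bound. *)
Lemma halts_within_inv (V : finType) Q (E : {set V * V})
    (I : nat -> state V -> Prop) :
  (forall c s, I c s -> (exists H r, s = Done H r) \/
     (exists k s', step Q E s k s') /\
     (forall k s', step Q E s k s' -> (0 < k <= c)%N /\ I (c - k)%N s')) ->
  forall c s, I c s -> halts_within Q E c s.
Proof.
move=> I_step c; elim/ltn_ind: c => c IH s /I_step[[H [r ->]]|[ex_step all_step]].
  exact: HaltsDone.
apply: HaltsStep => // k s' /all_step[/andP[k_gt0 le_kc] I_s']; split=> //.
by apply: IH I_s'; rewrite ltn_subrL k_gt0 (leq_trans k_gt0).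
Qed.

(** * The budget invariant of a run *)

Section RunningTime.
Variables (V : finType) (E : {set V * V}).
Notation edge := (V * V)%type.
Notation Q := bucket_queue.
Notation step := (step Q E).
Notation good := (good E).
Notation frame_inv := (frame_inv E).
Implicit Types (e : edge) (F H A B O : {set edge}) (r : {ffun V -> int}).
Implicit Types (f : frame V) (D : seq V) (u v x y : V) (m : store) (c k w : nat).

Definition priority f v : nat := if v \in fS f then `|ft f v|%N else 0%N.

Definition queue_rep f m c w : Prop :=
  exists2 P, forall v, P (vnum v) = priority f v & queue_inv #|V| m P c w.

(** Holds between the abstract update of [v] and the matching queue call, when the stored priority
    of [v] is out of date. *)
Definition queue_rep_but v f m c w : Prop :=
  exists2 P, forall x, x != v -> P (vnum x) = priority f x &
    queue_inv #|V| m P c w.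

Definition out_edges v : {set edge} := [set e in E | e.1 == v].
Definition in_edges v : {set edge} := [set e in E | e.2 == v].

(** Pays for the pops to come: 200 per incident edge cover its examination, a possible insertion and
    the unit of potential this creates; 100 cover the constant part of a pop. *)
Definition work D : nat :=
  (\sum_(v | v \notin D) (200 * (#|out_edges v| + #|in_edges v|) + 100))%N.

Definition round_cost : nat := (1000 * (#|V| + #|E| + 1))%N.
(** The current call lowers [num_slack], hence the predecessor; [#|E|.+1] pays for the test that
    follows the call. *)
Definition rest_cost f : nat :=
  (round_cost * (num_slack (fF f) (fr f)).-1 + #|E|.+1)%N.
(** Each link costs one unit when followed and one when flipped; 80 includes the last pop, which
    finds the queue empty. *)
Definition walk_cost : nat := (2 * #|V| + 80)%N.

(** Here [c] is the budget still available, and [60 * w] reserves the potential of the queue. In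
    [Enter], the [#|E|.+1] on the right is the part of the round already spent by [Pick]. *)
Definition state_inv c (s : state V) : Prop :=
  match s with
  | Test H r m => good H r /\ (round_cost * num_slack H r + #|E|.+1 <= c)%N
  | Defs.Pick H r m => [/\ good H r, exists2 e, e \in H & 0 < slack e r &
      (round_cost * num_slack H r <= c)%N]
  | Enter H r e m => [/\ good H r, e \in H, 0 < slack e r &
      (round_cost * num_slack H r <= c + #|E|.+1)%N]
  | Loop f m => exists D b w, [/\ frame_inv f D set0 set0 b, queue_rep f m b w &
      (work D + 60 * w + walk_cost + rest_cost f <= c)%N]
  | Scan f u A B m => exists D b w,
      [/\ frame_inv f D A B b, u \in D /\ ft f u = b%:Z,
          A \subset out_edges u /\ B \subset in_edges u, queue_rep f m b w &
      (200 * (#|A| + #|B|) + 1 + work D + 60 * w + walk_cost + rest_cost f <= c)%N]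
  | Insert f v u A B m => exists D b w,
      [/\ frame_inv f D A B b /\ v \in fS f, u \in D /\ ft f u = b%:Z,
          A \subset out_edges u /\ B \subset in_edges u, queue_rep_but v f m b w &
      (200 * (#|A| + #|B|) + 151 + work D + 60 * w + walk_cost + rest_cost f <= c)%N]
  | After f m => exists D b, [/\ frame_inv f D set0 set0 b, fS f = set0 &
      (2 * #|V| + 2 + rest_cost f <= c)%N]
  | Walk f x T m => exists D b, [/\ frame_inv f D set0 set0 b, fS f = set0,
      0 < slack (fps f) (fr' f), walk_inv E f D x T &
      (2 * index x D + #|T| + 1 + rest_cost f <= c)%N]
  | Done _ _ => True
  end.

Definition step_ok c s : Prop :=
  (exists k s', step s k s') /\
  (forall k s', step s k s' -> (0 < k <= c)%N /\ state_inv (c - k) s').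

Lemma vnum_lt v : (vnum v < #|V|)%N.
Proof. exact: ltn_ord. Qed.

Lemma vnum_inj : injective (@vnum V).
Proof. by move=> u v /val_inj/enum_rank_inj. Qed.

Lemma vnum_onto (i : nat) : (i < #|V|)%N -> exists v, vnum v = i.
Proof. by move=> lt_i; exists (enum_val (Ordinal lt_i)); rewrite /vnum enum_valK. Qed.

Lemma sum_degrees : (\sum_v (#|out_edges v| + #|in_edges v|) = 2 * #|E|)%N.
Proof.
have degE (g : edge -> V) : (\sum_v #|[set e in E | g e == v]| = #|E|)%N.
  rewrite -sum1_card (partition_big g predT) //=; apply: eq_bigr => v _.
  by rewrite -sum1_card; apply: eq_bigl => e; rewrite inE.
by rewrite big_split /= !degE mul2n addnn.
Qed.

Lemma work0 : work [::] = (400 * #|E| + 100 * #|V|)%N.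
Proof.
rewrite /work (eq_bigl predT) // big_split /= -big_distrr /= sum_degrees.
have -> : (\sum_(v : V) 100 = 100 * #|V|)%N by rewrite sum_nat_const mulnC.
by rewrite mulnA.
Qed.

Lemma work_rcons D u : u \notin D ->
  work D = (200 * (#|out_edges u| + #|in_edges u|) + 100 + work (rcons D u))%N.
Proof.
move=> uD; rewrite /work (bigD1 u) //=; congr (_ + _)%N; apply: eq_bigl => v.
by rewrite mem_rcons inE negb_or andbC.
Qed.

Lemma rest_cost_le f F r c : (num_slack F r < num_slack (fF f) (fr f))%N ->
  (rest_cost f <= c)%N -> (round_cost * num_slack F r + #|E|.+1 <= c)%N.
Proof.
move=> lt_F; apply: leq_trans; rewrite /rest_cost leq_add2r leq_mul2l.
by rewrite -ltnS (ltn_predK lt_F) lt_F orbT.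
Qed.

Lemma test_ok c H r m : state_inv c (Test H r m) -> step_ok c (Test H r m).
Proof.
case=> goodH le_c; split.
  have [le|lt] := leP (agony E r) #|H|%:Z.
    by eexists; eexists; apply: TestHalt.
  by eexists; eexists; apply: TestGo.
move=> k s' st; inversion st; subst; split; try lia; first by [].
split=> //; last by lia.
have [sHE euH confH _] := goodH.
(* If all slacks on [H] were 0, the agony would equal [#|H|] and the loop would have stopped. *)
case: (boolP [exists e in H, 0 < slack e r]) => [/exists_inP|]; first by [].
rewrite negb_exists_in => /forall_inP slack0.
have : #|H|%:Z < agony E r by [].
rewrite (agony_eulerian sHE euH confH) big1 ?addr0 ?natz ?ltxx // => e eH.
by apply/eqP; rewrite eq_le slack_ge0 leNgt slack0.
Qed.

Lemma pick_ok c H r m : state_inv c (Defs.Pick H r m) -> step_ok c (Defs.Pick H r m).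
Proof.
case=> goodH [e0 e0H slack0] le_c.
have ns_gt0 : (0 < num_slack H r)%N by apply/card_gt0P; exists e0; rewrite inE e0H.
split.
  case: (@arg_maxP _ _ _ e0 (mem H) (fun e => slack e r) e0H) => e eH max_e.
  by do 2 eexists; apply: (@PickEdge _ _ _ H r e m).
move=> k s' st; inversion st; subst.
have le_round : (#|E|.+1 <= round_cost * num_slack H r)%N.
  by apply: leq_trans (leq_pmulr _ ns_gt0); rewrite /round_cost; lia.
split; first by lia.
split=> //; last by lia.
have max_e e' : e' \in H -> slack e' r <= slack e r by auto.
exact: lt_le_trans slack0 (max_e e0 e0H).
Qed.

Ltac exec_determined ex :=
  match goal with
  | run : call _ _ _ _ _ _ |- _ => have [? ?] := exec_inj run ex; subst
  end.

Lemma enter_ok c H r e m : state_inv c (Enter H r e m) -> step_ok c (Enter H r e m).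
Proof.
case=> goodH eH slack_e le_c.
have ns_gt0 : (0 < num_slack H r)%N by apply/card_gt0P; exists e; rewrite inE eH.
set f := relief_init H r e.
have inv_f : frame_inv f [::] set0 set0 #|E| := relief_init_inv goodH eH slack_e.
have [|_ t_gt0 le_t] := inv_queued inv_f (v := e.1); first by rewrite inE.
have [k1 [m1 [ex1 le_k1 q1]]] := bucket_initP m #|V| #|E|.
have p_bounds : (0 < `|ft f e.1| <= #|E|)%N by lia.
have [k2 [m2 [ex2 le_k2 q2]]] := bucket_insertP (vnum_lt e.1) p_bounds q1.
split; first by do 2 eexists; exact: (@EnterRelief _ Q E H r e m k1 m1 k2 m2 slack_e ex1 ex2).
move=> k s' st; inversion st; subst.
exec_determined ex1; exec_determined ex2.
have le_sum : (#|V| + #|E| + k1 + k2 + 1 + work [::] + 60 * #|E|.+1 + walk_cost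
    + rest_cost f <= c)%N.
  rewrite work0 /walk_cost.
  rewrite -[rest_cost f]/(round_cost * (num_slack H r).-1 + #|E|.+1)%N.
  move: le_c; rewrite -{1}(prednK ns_gt0) mulnS.
  by move: (round_cost * _)%N => a; rewrite /round_cost; lia.
split; first by lia.
(* The potential is [#|E|] for the descent of the cursor plus one for the node of p. *)
exists [::], #|E|, #|E|.+1; split=> //; last first.
  by rewrite -[rest_cost _]/(rest_cost f); lia.
exists (upd (fun=> 0%N) (vnum e.1) `|ft f e.1|%N) => // v.
by rewrite /priority /upd (inj_eq vnum_inj) !inE; case: eqP => // ->.
Qed.

Lemma loop_ok c f m : state_inv c (Loop f m) -> step_ok c (Loop f m).
Proof.
case=> D [b [w [inv_f [P P_prio inv_q] le_c]]].
have [k [m' [ex_pop post]]] := bucket_popP inv_q.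
have exit : (k <= 70 + 60 * w)%N -> fS f = set0 ->
    (0 < k.+1 <= c)%N /\ state_inv (c - k.+1) (After f m').
  move=> le_k S0; have {}le_c : (k.+1 + (2 * #|V| + 2 + rest_cost f) <= c)%N.
    by move: le_c; rewrite /walk_cost; lia.
  by split; [lia|exists D, b; split=> //; lia].
have S_prio v : v \in fS f -> (0 < priority f v)%N.
  by move=> vS; rewrite /priority vS; have [_] := inv_queued inv_f vS; lia.
case: post => [[le_k reg0 P0]|[i [w' [le_k reg0 lt_i [Pi_gt0 max_i] inv_q']]]].
  have S0 : fS f = set0.
    by apply/setP=> v; rewrite inE; apply/negP => /S_prio; rewrite -P_prio P0 // vnum_lt.
  split; first by do 2 eexists; exact: (@LoopExit _ Q E f m k m' S0 ex_pop reg0).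
  move=> k' s' st; inversion st; subst.
    by have : u \in fS f by []; rewrite S0 inE.
  by exec_determined ex_pop; apply: exit.
have [u eq_u] := vnum_onto lt_i; subst i; rewrite !P_prio in Pi_gt0 inv_q' *.
have uS : u \in fS f by move: Pi_gt0; rewrite /priority; case: ifP.
have t_abs v : v \in fS f -> ft f v = (priority f v)%:Z.
  by move=> vS; rewrite /priority vS; have [_] := inv_queued inv_f vS; lia.
have max_u v : v \in fS f -> ft f v <= ft f u.
  by move=> vS; rewrite !t_abs // lez_nat -!P_prio; apply/max_i/vnum_lt.
split; first by do 2 eexists; exact: (@LoopPop _ Q E f u m k m' uS max_u ex_pop reg0).
have [uD _ _] := inv_queued inv_f uS.
have S_neq0 : fS f <> set0 by move=> S0; rewrite S0 inE in uS.
(* Ties are free in the abstract step, but the answer left in register 0 forces the choice of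
   [u]. *)
have reg0_inj v : regs m' 0 = (vnum v).+1 -> v = u by rewrite reg0 => -[/vnum_inj].
move=> k' s' st; inversion st; subst; last by [].
exec_determined ex_pop; have eq_u : u0 = u by auto.
subst u0; rewrite (work_rcons uD) in le_c.
split; first by lia.
exists (rcons D u), `|ft f u|%N, w'; split.
- exact: raise_inv inv_f uS max_u.
- by split; [rewrite mem_rcons inE eqxx|rewrite /=; move: (t_abs u uS); lia].
- by split.
- exists (upd P (vnum u) 0%N).
    move=> v; rewrite /upd (inj_eq vnum_inj) /priority !inE /=.
    by case: eqP => //= _; rewrite P_prio.
  by move: inv_q'; rewrite /priority uS.
- rewrite -/(out_edges u) -/(in_edges u) -[rest_cost (raise f u)]/(rest_cost f).
  by lia.
Qed.

Lemma queue_rep_enqueue f v t u e m c w :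
  queue_rep f m c w -> queue_rep_but v (enqueue f v t u e) m c w.
Proof.
case=> P P_prio inv_q; exists P => // x /negPf ne_x.
by rewrite P_prio /priority /= !inE ffunE ne_x.
Qed.

Lemma scan_ok c f u A B m :
  state_inv c (Scan f u A B m) -> step_ok c (Scan f u A B m).
Proof.
case=> D [b [w [inv_f [uD t_u] [sA sB] rep_q le_c]]].
have outE e : e \in A -> e \in E /\ e.1 = u.
  by move=> /(subsetP sA); rewrite inE => /andP[-> /eqP].
have inE' e : e \in B -> e.2 = u.
  by move=> /(subsetP sB); rewrite inE => /andP[_ /eqP].
have subA e : A :\ e \subset out_edges u by apply: subset_trans sA; apply: subD1set.
have subB e : B :\ e \subset in_edges u by apply: subset_trans sB; apply: subD1set.
split.
  have [A0|[e eA]] := set_0Vmem A; last first.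
    have [rel|norel] := boolP (out_relaxes f e).
      by do 2 eexists; apply: ScanOut eA rel.
    by do 2 eexists; apply: ScanOutSkip eA norel.
  rewrite A0; have [->|[e eB]] := set_0Vmem B.
    by do 2 eexists; apply: ScanEnd.
  have [rel|norel] := boolP (in_relaxes f e).
    by do 2 eexists; apply: ScanIn eB rel.
  by do 2 eexists; apply: ScanInSkip eB norel.
move=> k s' st; inversion st; subst; (split; first by lia).
- have eA : e \in A by [].
  have [eE e1] := outE e eA; rewrite (cardsD1 e) eA in le_c.
  exists D, b, w; split=> //; last by lia.
  exact: scan_out_skip_inv e1 _.
- have eA : e \in A by [].
  have [eE e1] := outE e eA; rewrite (cardsD1 e) eA in le_c.
  have [//|vD inv_f'] := scan_out_inv inv_f uD t_u eE e1.
  exists D, b, w; split=> //.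
  + by split=> //; rewrite !inE eqxx.
  + split=> //=; rewrite ffunE; case: eqP => // eq_u.
    by rewrite -eq_u uD in vD.
  + exact: queue_rep_enqueue.
  + by rewrite -[rest_cost (enqueue _ _ _ _ _)]/(rest_cost f); lia.
- have eB : e \in B by [].
  have e2 := inE' e eB; rewrite (cardsD1 e B) eB in le_c.
  exists D, b, w; split=> //; last by lia.
  exact: scan_in_skip_inv e2 _.
- have eB : e \in B by [].
  have e2 := inE' e eB; rewrite (cardsD1 e B) eB in le_c.
  have [//|vD inv_f'] := scan_in_inv inv_f uD t_u e2.
  exists D, b, w; split=> //.
  + by split=> //; rewrite !inE eqxx.
  + split=> //=; rewrite ffunE; case: eqP => // eq_u.
    by rewrite -eq_u uD in vD.
  + exact: queue_rep_enqueue.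
  + by rewrite -[rest_cost (enqueue _ _ _ _ _)]/(rest_cost f); lia.
- by exists D, b, w; split=> //; lia.
Qed.

Lemma insert_ok c f v u A B m :
  state_inv c (Insert f v u A B m) -> step_ok c (Insert f v u A B m).
Proof.
case=> D [b [w [[inv_f vS] u_ok sAB [P P_prio inv_q] le_c]]].
have [_ t_gt0 le_t] := inv_queued inv_f vS.
have p_bounds : (0 < `|ft f v| <= b)%N by lia.
have [k [m' [ex_ins le_k inv_q']]] := bucket_insertP (vnum_lt v) p_bounds inv_q.
split; first by do 2 eexists; exact: (@InsertCall _ Q E f v u A B m k m' ex_ins).
move=> k' s' st; inversion st; subst.
exec_determined ex_ins; split; first by lia.
exists D, b, w.+1; split=> //; last by lia.
exists (upd P (vnum v) `|ft f v|%N) => // x.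
rewrite /upd (inj_eq vnum_inj); have [->|ne_x] := eqVneq x v; last exact: P_prio.
by rewrite /priority vS.
Qed.

Lemma after_ok c f m : state_inv c (After f m) -> step_ok c (After f m).
Proof.
case=> D [b [inv_f S0 le_c]]; split.
  have [le0|gt0] := leP (slack (fps f) (fr' f)) 0.
    by do 2 eexists; apply: AfterKeep.
  by do 2 eexists; apply: AfterWalk.
move=> k s' st; inversion st; subst; (split; first by lia).
  have [//|goodF lt_F] := end_keep inv_f S0.
  by split=> //; apply: rest_cost_le lt_F _; lia.
exists D, b; split=> //; first exact: (walk_start inv_f S0).
have : (index (fps f).2 D <= #|V|)%N.
  by apply: leq_trans (index_size _ _) _; rewrite -(card_uniqP (inv_uniq inv_f)) max_card.
by rewrite cards0; lia.
Qed.

Lemma walk_ok c f x O m : state_inv c (Walk f x O m) -> step_ok c (Walk f x O m).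
Proof.
case=> D [b [inv_f S0 gt0 inv_w le_c]]; split.
  have [->|ne_x] := eqVneq x (fps f).1; first by do 2 eexists; apply: WalkEnd.
  have [y [e [eq_par _ _]]] := walk_step inv_f S0 inv_w ne_x.
  by do 2 eexists; apply: WalkUp ne_x eq_par.
have next y e : x != (fps f).1 -> fpar f x = Some (y, e) ->
    walk_inv E f D y (e |: O) /\ (index y D < index x D)%N.
  move=> /(walk_step inv_f S0 inv_w)[y' [e' [eq_par inv_w' lt_y]]].
  by rewrite eq_par => -[<- <-].
move=> k s' st; inversion st; subst.
  have [inv_w' lt_y] : walk_inv E f D y (e |: O) /\ (index y D < index x D)%N.
    exact: next.
  have le_card : (#|e |: O| <= #|O|.+1)%N.
    by rewrite cardsU1 -add1n leq_add2r leq_b1.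
  split; first by lia.
  (* The index drops by at least one, releasing two units: one for this step, one for a new edge in
     [O]. *)
  have le_c' : (2 * index y D + #|e |: O| + 1 + rest_cost f <= c - 1)%N by lia.
  by exists D, b.
split; first by lia.
have [goodF lt_F] := walk_end inv_f S0 inv_w gt0.
by split=> //; apply: rest_cost_le lt_F _; lia.
Qed.

Lemma minagony_halts c s : state_inv c s -> halts_within Q E c s.
Proof.
apply: halts_within_inv c s => c [H r m|H r m|H r e m|f m|f u A B m|f v u A B m
  |f m|f x T m|H r] inv_s; last (by left; exists H, r); right.
- exact: test_ok.
- exact: pick_ok.
- exact: enter_ok.
- exact: loop_ok.
- exact: scan_ok.
- exact: insert_ok.
- exact: after_ok.
- exact: walk_ok.
Qed.

End RunningTime.

(** * The quadratic bound *)

Theorem proposition5 :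
  exists Q : pqueue,
  forall K : nat, exists C : nat,
  forall (V : finType) (E H : {set V * V}) (r : {ffun V -> int}),
    (0 < #|E|)%N -> (#|V| <= K * #|E|)%N ->
    max_eulerian E H ->
    conforms E H r ->
    (forall e, e \in H -> slack e r <= #|E|%:Z) ->
    minagony_time_le Q E H r (C * #|E| ^ 2).
Proof.
(* A round costs at most [1000 * (K + 2) * #|E|] and there are at most [#|E|] rounds; the third 1000
   absorbs the last test. *)
exists bucket_queue => K; exists (1000 * (K + 3))%N.
move=> V E H r E_gt0 leV /maxsetp/andP[sHE euH] confH slackH m.
apply: minagony_halts; split=> //.
have ns_le : (num_slack H r <= #|E|)%N.
  by apply: subset_leq_card; apply/subsetP=> e; rewrite inE => /andP[/(subsetP sHE)].
have : (round_cost E * num_slack H r <= round_cost E * #|E|)%N by rewrite leq_mul2l ns_le orbT.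
have : (round_cost E <= 1000 * (K + 2) * #|E|)%N by rewrite /round_cost; nia.
rewrite -mulnn; nia.
Qed.
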